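(* Let $\varphi\colon\Gamma\to G$ be a homomorphism of groups, with free normal closure $\Gamma\xrightarrow{c_\varphi}\Gamma^\varphi\xrightarrow{\overline{\varphi}}G$ and normal closures tower $\cdots\to\Gamma_{k+1}\xrightarrow{\overline{\varphi_k}}\Gamma_k\to\cdots\to\Gamma_2\xrightarrow{\overline{\varphi_1}}\Gamma_1=G$. Let $\Gamma_\infty:=\varprojlim\Gamma_i$, and let $\varphi_\infty\colon\Gamma\to\Gamma_\infty$ be the map induced by the compatible maps $\varphi_i\colon\Gamma\to\Gamma_i$ via the universal property of $\Gamma_\infty$. Then (1) the map $(c_\varphi)_{ab}\colon\Gamma_{ab}\to(\Gamma^\varphi)_{ab}$ induced by $c_\varphi$ on abelianizations is injective; (2) the map $(\varphi_\infty)_{ab}\colon\Gamma_{ab}\to(\Gamma_\infty)_{ab}$ induced by $\varphi_\infty$ on abelianizations is injective.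
   Context: Notation: $h^g=g^{-1}hg$ in a group; $H_{ab}=H/[H,H]$. A normal map (crossed module) is a group homomorphism $n\colon M\to G$ together with a right action of $G$ on $M$ by automorphisms, $(a,g)\mapsto a^g$ (the normal structure), such that (NM1) $n(a^g)=n(a)^g$ for all $a\in M$, $g\in G$; (NM2) $a^{n(b)}=a^b=b^{-1}ab$ for all $a,b\in M$. A normal morphism over $G$ from $n_1\colon M_1\to G$ to $n_2\colon M_2\to G$ is a homomorphism $\mu\colon M_1\to M_2$ with $n_2(\mu(a))=n_1(a)$ and $\mu(a^g)=\mu(a)^g$ for all $a\in M_1$, $g\in G$. The free normal closure of a homomorphism $\varphi\colon\Gamma\to G$ is a factorization $\Gamma\xrightarrow{c_\varphi}\Gamma^\varphi\xrightarrow{\overline\varphi}G$ of $\varphi$ (so $\overline\varphi(c_\varphi(\gamma))=\varphi(\gamma)$) with $\overline\varphi$ a normal map, such that for every factorization $\Gamma\xrightarrow{\psi}M\xrightarrow{n}G$ of $\varphi$ with $n$ a normal map there is a unique normal morphism $\overline\psi\colon\Gamma^\varphi\to M$ over $G$ with $\overline\psi(c_\varphi(\gamma))=\psi(\gamma)$ for all $\gamma\in\Gamma$. It exists and is unique up to isomorphism of normal maps over $G$. The normal closures tower of $\varphi$ is defined by $\varphi_1:=\varphi$, $\Gamma_1:=G$ and inductively, for $i\ge1$, $\Gamma_{i+1}:=\Gamma^{\varphi_i}$, $\varphi_{i+1}:=c_{\varphi_i}\colon\Gamma\to\Gamma_{i+1}$, with the normal maps $\overline{\varphi_i}\colon\Gamma_{i+1}\to\Gamma_i$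 satisfying $\overline{\varphi_i}(\varphi_{i+1}(\gamma))=\varphi_i(\gamma)$. *)

(* Defs.v *)
From HB Require Import structures.
From mathcomp Require Import all_boot.
From mathcomp Require Import monoid generic_quotient boolp.

Set Implicit Arguments.
Unset Strict Implicit.
Unset Printing Implicit Defensive.

Import Algebra.

Local Open Scope group_scope.
Local Open Scope quotient_scope.

Notation "{ 'ghom' G -> H }" := (UMagmaMorphism.type G%type H%type)
  (at level 0, G at level 98, H at level 99, format "{ 'ghom'  G  ->  H }")
  : type_scope.

Section Abelianization.
Variable H : groupType.

(* [H, H], as the smallest subgroup containing all commutators. *)
Definition derived : {pred H} := fun x =>
  `[< forall S : {pred H},
        group_closed S -> (forall a b, [~ a, b] \in S) -> x \in S >].

Lemma derivedP x :
  reflect (forall S : {pred H},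
             group_closed S -> (forall a b, [~ a, b] \in S) -> x \in S)
          (x \in derived).
Proof. exact: asboolP. Qed.

Lemma derived_closed : group_closed derived.
Proof.
split; first by apply/derivedP => S [].
move=> x y /derivedP dx /derivedP dy; apply/derivedP => S gS cS.
by case: (gS) => _; apply; [apply: dx | apply: dy].
Qed.

Lemma derivedR a b : [~ a, b] \in derived.
Proof. by apply/derivedP. Qed.

Lemma derivedV x : x \in derived -> x^-1 \in derived.
Proof. exact: (group_closedV derived_closed). Qed.

Lemma derivedM x y : x \in derived -> y \in derived -> x * y \in derived.
Proof. exact: (group_closedM derived_closed). Qed.

Lemma derivedJ x y : x \in derived -> x ^ y \in derived.
Proof.
move=> dx; have -> : x ^ y = x * [~ x, y] by rewrite commgEl mulVKg.
by apply: derivedM => //; apply: derivedR.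
Qed.

Definition abel_eq (x y : H) := x^-1 * y \in derived.

Lemma abel_eq_refl : reflexive abel_eq.
Proof. by move=> x; rewrite /abel_eq mulVg; case: derived_closed. Qed.

Lemma abel_eq_sym : symmetric abel_eq.
Proof.
suff le x y : abel_eq x y -> abel_eq y x by move=> x y; apply/idP/idP; apply: le.
by rewrite /abel_eq => /derivedV; rewrite invgM invgK.
Qed.

Lemma abel_eq_trans : transitive abel_eq.
Proof.
move=> y x z; rewrite /abel_eq => xy yz.
by have := derivedM xy yz; rewrite mulgA mulgK.
Qed.

Canonical abel_equiv := EquivRel abel_eq abel_eq_refl abel_eq_sym abel_eq_trans.

Definition abel := {eq_quot abel_equiv}.

HB.instance Definition _ := Choice.on abel.
HB.instance Definition _ := EqQuotient.on abel.

Lemma abel_piP x y : \pi_abel x = \pi_abel y <-> x^-1 * y \in derived.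
Proof. by split=> [/eqP|h]; [|apply/eqP]; rewrite eqmodE. Qed.

Lemma abel_piM x x' y y' : \pi_abel x = \pi_abel x' -> \pi_abel y = \pi_abel y' ->
  \pi_abel (x * y) = \pi_abel (x' * y').
Proof.
move=> /abel_piP dx /abel_piP dy; apply/abel_piP.
have -> : (x * y)^-1 * (x' * y') = (x^-1 * x') ^ y * (y^-1 * y').
  by rewrite conjgE invgM !mulgA mulgK.
by apply: derivedM => //; apply: derivedJ.
Qed.

Lemma abel_piV x x' : \pi_abel x = \pi_abel x' -> \pi_abel x^-1 = \pi_abel x'^-1.
Proof.
move=> /abel_piP /derivedV dx; apply/abel_piP.
have -> : x^-1^-1 * x'^-1 = ((x^-1 * x')^-1) ^ x'^-1.
  by rewrite conjgE invgM !invgK !mulgA mulgV mul1g.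
exact: derivedJ.
Qed.

Lemma abel_ind (P : abel -> Prop) : (forall x, P (\pi_abel x)) -> forall u, P u.
Proof. by move=> Px u; rewrite -[u]reprK. Qed.

Definition abel_mul (u v : abel) : abel := \pi_abel (repr u * repr v).
Definition abel_one : abel := \pi_abel 1.
Definition abel_inv (u : abel) : abel := \pi_abel (repr u)^-1.

Lemma pi_mul x y : abel_mul (\pi_abel x) (\pi_abel y) = \pi_abel (x * y).
Proof. by apply: abel_piM; rewrite reprK. Qed.

Lemma pi_inv x : abel_inv (\pi_abel x) = \pi_abel x^-1.
Proof. by apply: abel_piV; rewrite reprK. Qed.

Lemma abel_mulA : associative abel_mul.
Proof. by elim/abel_ind=> x; elim/abel_ind=> y; elim/abel_ind=> z; rewrite !pi_mul mulgA. Qed.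

Lemma abel_mul1 : left_id abel_one abel_mul.
Proof. by elim/abel_ind=> x; rewrite pi_mul mul1g. Qed.

Lemma abel_mul1r : right_id abel_one abel_mul.
Proof. by elim/abel_ind=> x; rewrite pi_mul mulg1. Qed.

Lemma abel_mulV : left_inverse abel_one abel_inv abel_mul.
Proof. by elim/abel_ind=> x; rewrite pi_inv pi_mul mulVg. Qed.

Lemma abel_mulVr : right_inverse abel_one abel_inv abel_mul.
Proof. by elim/abel_ind=> x; rewrite pi_inv pi_mul mulgV. Qed.

HB.instance Definition _ :=
  isGroup.Build abel abel_mulA abel_mul1 abel_mul1r abel_mulV abel_mulVr.

Lemma abel_mulC (u v : abel) : u * v = v * u.
Proof.
elim/abel_ind: u => x; elim/abel_ind: v => y; rewrite [LHS]pi_mul [RHS]pi_mul.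
apply/abel_piP; have -> : (x * y)^-1 * (y * x) = [~ y, x].
  by rewrite invgM -mulgA.
exact: derivedR.
Qed.

Definition abel_pi (x : H) : abel := \pi_abel x.

Lemma abel_pi_morphism : monoid_morphism abel_pi.
Proof. by split=> [|x y] /=; [|exact: (esym (pi_mul x y))]. Qed.

HB.instance Definition _ := isUMagmaMorphism.Build H abel abel_pi abel_pi_morphism.

End Abelianization.

Arguments derived : clear implicits.

Section AbelianizationMap.
Variables (G H : groupType) (f : {ghom G -> H}).

Lemma derived_ghom x : x \in derived G -> f x \in derived H.
Proof.
move=> /derivedP/(_ (fun y => f y \in derived H)); apply.
  split=> [|y z dy dz]; rewrite /in_mem /= ?gmulf1 ?gmulfF.
    by case: (derived_closed H).
  by case: (derived_closed H) => _; apply.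
by move=> a b; rewrite /in_mem /= gmulfR; apply: derivedR.
Qed.

(* Defined through representatives; abel_map_pi shows that it is the map *)
(* induced by f.                                                         *)
Definition abel_map (u : abel G) : abel H := abel_pi (f (repr u)).

Lemma abel_map_pi x : abel_map (abel_pi x) = abel_pi (f x).
Proof.
apply/abel_piP; rewrite -gmulfV -gmulfM; apply: derived_ghom.
by apply/abel_piP; rewrite reprK.
Qed.

Lemma abel_map_morphism : monoid_morphism abel_map.
Proof.
split.
  have -> : 1 = abel_pi 1 :> abel G by rewrite gmulf1.
  by rewrite abel_map_pi !gmulf1.
elim/abel_ind=> x; elim/abel_ind=> y; rewrite -!/(abel_pi _).
by rewrite -gmulfM !abel_map_pi !gmulfM.
Qed.

HB.instance Definition _ :=
  isUMagmaMorphism.Build (abel G) (abel H) abel_map abel_map_morphism.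

End AbelianizationMap.

(* The conjugate a ^ b of the library is b^-1 * (a * b). *)
Record normal_map (M G : groupType) := NormalMap {
  nm_hom :> {ghom M -> G};
  nm_act : M -> G -> M;
  nm_act1 : forall a, nm_act a 1 = a;
  nm_actM : forall a g h, nm_act a (g * h) = nm_act (nm_act a g) h;
  nm_act_mul : forall a b g, nm_act (a * b) g = nm_act a g * nm_act b g;
  nm_equivariant : forall a g, nm_hom (nm_act a g) = nm_hom a ^ g;
  nm_peiffer : forall a b, nm_act a (nm_hom b) = a ^ b
}.

Definition normal_morphism (G M1 M2 : groupType) (n1 : normal_map M1 G)
    (n2 : normal_map M2 G) (mu : {ghom M1 -> M2}) : Prop :=
  (forall a, n2 (mu a) = n1 a) /\
  (forall a g, mu (nm_act n1 a g) = nm_act n2 (mu a) g).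

Definition free_normal_closure (Gam G N : groupType) (phi : {ghom Gam -> G})
    (c : {ghom Gam -> N}) (n : normal_map N G) : Prop :=
  (forall x, n (c x) = phi x) /\
  (forall (M : groupType) (psi : {ghom Gam -> M}) (m : normal_map M G),
     (forall x, m (psi x) = phi x) ->
     exists mu : {ghom N -> M},
       [/\ normal_morphism n m mu, forall x, mu (c x) = psi x
         & forall nu : {ghom N -> M}, normal_morphism n m nu ->
             (forall x, nu (c x) = psi x) -> nu =1 mu]).

Section InverseLimit.
Variables (G : nat -> groupType) (p : forall i, {ghom G i.+1 -> G i}).

Record invlim := InvLim {
  invlim_val :> forall i, G i;
  invlim_compat : forall i, p i (invlim_val i.+1) = invlim_val i
}.

Lemma invlim_inj (x y : invlim) : (forall i, x i = y i) -> x = y.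
Proof.
case: x y => [x xp] [y yp] /= xy.
have {}xy : x = y by apply: functional_extensionality_dep.
by case: _ / xy yp => yp; congr InvLim; apply: Prop_irrelevance.
Qed.

HB.instance Definition _ := gen_eqMixin invlim.
HB.instance Definition _ := gen_choiceMixin invlim.

Lemma invlim_mul_compat (x y : invlim) i : p i (x i.+1 * y i.+1) = x i * y i.
Proof. by rewrite gmulfM !invlim_compat. Qed.

Lemma invlim_inv_compat (x : invlim) i : p i (x i.+1)^-1 = (x i)^-1.
Proof. by rewrite gmulfV invlim_compat. Qed.

Definition invlim_mul (x y : invlim) := InvLim (invlim_mul_compat x y).
Definition invlim_one := @InvLim (fun=> 1) (fun=> gmulf1).
Definition invlim_inv (x : invlim) := InvLim (invlim_inv_compat x).

Lemma invlim_mulA : associative invlim_mul.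
Proof. by move=> x y z; apply: invlim_inj => i; apply: mulgA. Qed.

Lemma invlim_mul1 : left_id invlim_one invlim_mul.
Proof. by move=> x; apply: invlim_inj => i; apply: mul1g. Qed.

Lemma invlim_mul1r : right_id invlim_one invlim_mul.
Proof. by move=> x; apply: invlim_inj => i; apply: mulg1. Qed.

Lemma invlim_mulV : left_inverse invlim_one invlim_inv invlim_mul.
Proof. by move=> x; apply: invlim_inj => i; apply: mulVg. Qed.

Lemma invlim_mulVr : right_inverse invlim_one invlim_inv invlim_mul.
Proof. by move=> x; apply: invlim_inj => i; apply: mulgV. Qed.

HB.instance Definition _ := isGroup.Build invlim
  invlim_mulA invlim_mul1 invlim_mul1r invlim_mulV invlim_mulVr.

Variables (Gam : groupType) (f : forall i, {ghom Gam -> G i}).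
Hypothesis f_compat : forall i x, p i (f i.+1 x) = f i x.

Definition invlim_map (x : Gam) : invlim :=
  @InvLim (fun i => f i x) (fun i => f_compat i x).

Lemma invlim_map_morphism : monoid_morphism invlim_map.
Proof.
by split=> [|x y]; apply: invlim_inj => i; [apply: gmulf1 | apply: gmulfM].
Qed.

HB.instance Definition _ :=
  isUMagmaMorphism.Build Gam invlim invlim_map invlim_map_morphism.

End InverseLimit.

(* Levels are numbered from 0: level 0 is phi : Gam -> G, and level i here is *)
(* phi_(i+1) : Gam -> Gam_(i+1) in the usual numbering.                       *)
Definition tower_obj (G : groupType) (N : nat -> groupType) (i : nat)
  : groupType := if i is j.+1 then N j else G.

Definition tower_hom (Gam G : groupType) (phi : {ghom Gam -> G})
    (N : nat -> groupType) (c : forall j, {ghom Gam -> N j}) (i : nat)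
  : {ghom Gam -> tower_obj G N i} :=
  match i with 0 => phi | j.+1 => c j end.

(* The free normal closure is only determined up to isomorphism over its      *)
(* target, so a tower records the choice made at every level.                 *)
Record closures_tower (Gam G : groupType) (phi : {ghom Gam -> G}) :=
  ClosuresTower {
    ct_closure : nat -> groupType;
    ct_unit : forall i, {ghom Gam -> ct_closure i};
    ct_map : forall i, normal_map (ct_closure i) (tower_obj G ct_closure i);
    ct_free : forall i,
      free_normal_closure (tower_hom phi ct_unit i) (ct_unit i) (ct_map i)
  }.

Section TowerLimit.
Variables (Gam G : groupType) (phi : {ghom Gam -> G}) (T : closures_tower phi).

Definition tower_group (i : nat) : groupType := tower_obj G (ct_closure T) i.

Definition tower_map (i : nat) : {ghom Gam -> tower_group i} :=
  tower_hom phi (@ct_unit _ _ _ T) i.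

Definition tower_proj (i : nat) : {ghom tower_group i.+1 -> tower_group i} :=
  ct_map T i.

Lemma tower_compat i x : tower_proj i (tower_map i.+1 x) = tower_map i x.
Proof. by case: (ct_free T i) => + _; apply. Qed.

Definition tower_limit : groupType := invlim tower_proj.

Definition tower_limit_map : {ghom Gam -> tower_limit} :=
  invlim_map tower_compat.

End TowerLimit.

(* Main.v *)
(* The projection G * Gam_ab -> G, with G acting by conjugation on the first  *)
(* factor and trivially on the second, is a normal map through which phi      *)
(* factors by x |-> (phi x, [x]). The universal property therefore extends    *)
(* Gam -> Gam_ab along c, which forces c_ab to be injective. For the limit,   *)
(* Gam -> Gam_2 factors through phi_infty, so (2) follows from (1).           *)
Require Import Defs.
From mathcomp Require Import ssreflect ssrfun monoid.
From HB Require Import structures.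
From mathcomp Require Import all_boot.

Set Implicit Arguments.
Unset Strict Implicit.
Unset Printing Implicit Defensive.

Import Algebra.

Local Open Scope group_scope.

(** Injectivity on abelianizations means that only elements of [Gam, Gam] land in the derived
    subgroup ([abel_map_inj_derived]). The morphism that freeness gives from N to G * Gam_ab,
    followed by [snd], has abelian target, so it kills [c x] when [c x] is in [N, N]
    ([derived_ghom_abel]); but it sends [c x] to the class of x. *)

Lemma abel_map_inj_derived (G H : groupType) (f : {ghom G -> H}) :
  injective (abel_map f) <-> forall x, f x \in derived H -> x \in derived G.
Proof.
split=> [f_inj x dfx | f_der].
  have /abel_piP : abel_pi 1 = abel_pi x.
    apply: f_inj; rewrite !abel_map_pi; apply/abel_piP.
    by rewrite gmulf1 invg1 mul1g.
  by rewrite invg1 mul1g.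
elim/abel_ind=> x; elim/abel_ind=> y; rewrite -!/(abel_pi _) !abel_map_pi.
by move=> /abel_piP; rewrite -gmulfV -gmulfM => /f_der ?; apply/abel_piP.
Qed.

Lemma derived_ghom_abel (H K : groupType) (f : {ghom H -> abel K}) x :
  x \in derived H -> f x = 1.
Proof.
move=> /derivedP/(_ (fun y => f y == 1)) h; apply/eqP; apply: h.
  split=> [|y z]; rewrite /in_mem /= ?gmulf1 // gmulfF.
  by move=> /eqP -> /eqP ->; rewrite invg1 mulg1.
move=> a b; rewrite /in_mem /= gmulfR; apply/eqP.
by rewrite commgEl conjgE (abel_mulC (f a)) !mulKg mulVg.
Qed.

Section ProductNormalMap.
Variables G K : groupType.

Definition prod_act (a : G * abel K) (g : G) : G * abel K := (a.1 ^ g, a.2).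

Lemma prod_act1 a : prod_act a 1 = a.
Proof. by case: a => g u; rewrite /prod_act conjg1. Qed.

Lemma prod_actM a g h : prod_act a (g * h) = prod_act (prod_act a g) h.
Proof. by rewrite /prod_act conjgM. Qed.

Lemma prod_act_mul a b g : prod_act (a * b) g = prod_act a g * prod_act b g.
Proof. by congr pair; apply: conjMg. Qed.

(** The factor [abel K] is commutative, so conjugation by b only sees its first component, which is
    its image in G. *)
Lemma prod_peiffer (a b : G * abel K) : prod_act a b.1 = a ^ b.
Proof.
case: a b => [g u] [h v]; congr pair.
by rewrite /= -[RHS]/(v^-1 * (u * v)) (abel_mulC u) mulKg.
Qed.

Definition prod_normal_map : normal_map (G * abel K)%type G :=
  @NormalMap _ _ (fst : {ghom (G * abel K)%type -> G})
    prod_act prod_act1 prod_actM prod_act_mul (fun _ _ => erefl) prod_peiffer.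

End ProductNormalMap.

Section Pairing.
Variables (Gam G : groupType) (phi : {ghom Gam -> G}).

Definition pair_abel (x : Gam) : G * abel Gam := (phi x, abel_pi x).

Lemma pair_abel_morphism : monoid_morphism pair_abel.
Proof. by split=> [|x y]; rewrite /pair_abel ?gmulf1 ?gmulfM. Qed.

HB.instance Definition _ := isUMagmaMorphism.Build Gam (G * abel Gam)%type
  pair_abel pair_abel_morphism.

End Pairing.

Lemma free_normal_closure_abel_inj (Gam G N : groupType) (phi : {ghom Gam -> G})
    (c : {ghom Gam -> N}) (n : normal_map N G) :
  free_normal_closure phi c n -> injective (abel_map c).
Proof.
move=> [_ univ]; apply/abel_map_inj_derived => x dcx.
have [|mu [_ muc _]] := univ _ (pair_abel phi) (prod_normal_map G Gam).
  by [].
(* Only the [snd] component of mu matters: it extends Gam -> Gam_ab along c. *)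
have : (mu (c x)).2 = 1 := derived_ghom_abel (snd \o mu) dcx.
rewrite muc => /esym.
by move=> /abel_piP; rewrite invg1 mul1g.
Qed.

Section InverseLimitProjection.
Variables (G : nat -> groupType) (p : forall i, {ghom G i.+1 -> G i}) (i : nat).

Definition invlim_proj (x : invlim p) : G i := x i.

Lemma invlim_proj_morphism : monoid_morphism invlim_proj.
Proof. by []. Qed.

HB.instance Definition _ := isUMagmaMorphism.Build (invlim p) (G i)
  invlim_proj invlim_proj_morphism.

End InverseLimitProjection.

Theorem proposition1p9 (Gam G : groupType) (phi : {ghom Gam -> G}) :
  (forall (N : groupType) (c : {ghom Gam -> N}) (n : normal_map N G),
     free_normal_closure phi c n -> injective (abel_map c)) /\
  (forall T : closures_tower phi, injective (abel_map (tower_limit_map T))).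
Proof.
split=> [N c n|T]; first exact: free_normal_closure_abel_inj.
apply/abel_map_inj_derived => x dx.
(* The closure of phi sits at level 1 of the tower: its unit [ct_unit T 0] is [tower_map T 1], hence
   the projection of index 1 carries [dx] to it. *)
have /abel_map_inj_derived := free_normal_closure_abel_inj (ct_free T 0).
by apply; apply: (derived_ghom (@invlim_proj _ (tower_proj T) 1) dx).
Qed.
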